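(* There is a universal constant $C$ such that the following holds. Let $V_1,V_2,V_3$ be pairwise disjoint finite subsets of $\mathbb{C}^d$ forming a 3MR configuration, and let $V=V_1\cup V_2\cup V_3$. Then $\dim(V)\le C$.
   Context: $V_1,V_2,V_3$ (pairwise disjoint finite sets of distinct points in $\mathbb{C}^d$) form a 3MR configuration if every line $\ell$ such that $\ell\cap(V_1\cup V_2\cup V_3)$ has more than one point intersects at least two of the sets $V_1,V_2,V_3$. $\dim(V)$ is the dimension of the smallest affine subspace containing $V$. *)

(* Defs.v *)
From mathcomp Require Import all_boot all_order all_algebra.
From mathcomp Require Import boolp classical_sets cardinality reals.
From mathcomp Require Import complex.

Set Implicit Arguments.
Unset Strict Implicit.
Unset Printing Implicit Defensive.

Import GRing.Theory.
Local Open Scope classical_set_scope.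
Local Open Scope ring_scope.

Definition translate (F : fieldType) (d : nat) (a : 'rV[F]_d)
    (W : {vspace 'rV[F]_d}) : set 'rV[F]_d :=
  [set x | x - a \in W].

Definition affine_subspace (F : fieldType) (d : nat) (A : set 'rV[F]_d) : Prop :=
  exists a W, A = translate a W.

(* The default 0%VS is only reached when A is not an affine subspace. *)
Definition direction (F : fieldType) (d : nat) (A : set 'rV[F]_d) :
    {vspace 'rV[F]_d} :=
  xget 0%VS [set W | exists a, A = translate a W].

Definition affine_hull (F : fieldType) (d : nat) (V : set 'rV[F]_d) :
    set 'rV[F]_d :=
  smallest (@affine_subspace F d) V.

(* With these conventions adim set0 = 0. *)
Definition adim (F : fieldType) (d : nat) (V : set 'rV[F]_d) : nat :=
  \dim (direction (affine_hull V)).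

Definition line (F : fieldType) (d : nat) (L : set 'rV[F]_d) : Prop :=
  exists a u : 'rV[F]_d, u != 0 /\ L = [set a + t *: u | t in [set: F]].

Definition meets (T : Type) (A B : set T) : Prop := A `&` B !=set0.

Definition three_MR (F : fieldType) (d : nat) (V1 V2 V3 : set 'rV[F]_d) : Prop :=
  forall L : set 'rV[F]_d, line L ->
    (exists x y, [/\ x <> y, (L `&` (V1 `|` V2 `|` V3)) x
                           & (L `&` (V1 `|` V2 `|` V3)) y]) ->
    [\/ meets L V1 /\ meets L V2,
        meets L V1 /\ meets L V3
      | meets L V2 /\ meets L V3].

Section AffineFacts.
Context (F : fieldType) (d : nat).
Implicit Types (a : 'rV[F]_d) (A V : set 'rV[F]_d) (W : {vspace 'rV[F]_d}).

Lemma translate_mem a b W : translate a W b -> translate a W = translate b W.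
Proof.
rewrite /translate /= => hb; apply/seteqP; split=> x /= hx.
  have -> : x - b = (x - a) - (b - a) by rewrite opprB addrA subrK.
  by rewrite rpredB.
have -> : x - a = (x - b) + (b - a) by rewrite addrA subrK.
by rewrite rpredD.
Qed.

Lemma direction_translate a W : direction (translate a W) = W.
Proof.
rewrite /direction; case: xgetP => [U _ [b e]|/(_ W)]; last by case; exists a.
have ab : translate b U a by rewrite -e /translate /= subrr rpred0.
rewrite (translate_mem ab) in e.
apply/vspaceP => w.
have := congr1 (fun A : set _ => A (w + a)) e.
by rewrite /translate /= addrK => h; apply/idP/idP; rewrite h.
Qed.

Lemma affine_hull_affine V : V !=set0 -> affine_subspace (affine_hull V).
Proof.
move=> [a Va].
pose P k := `[< exists W, \dim W = k /\ V `<=` translate a W >].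
have exP : exists k, P k.
  exists (\dim (fullv : {vspace 'rV[F]_d})); apply/asboolP; exists fullv.
  by split=> // x _; rewrite /translate /= memvf.
case: (ex_minnP exP) => k /asboolP [W [dW VW]] kmin.
exists a, W; apply/seteqP; split.
  by move=> x; apply; split=> //; exists a, W.
move=> x Wx B [[b [U ->]] VU].
have aU := VU _ Va; rewrite (translate_mem aU) in VU *.
have VI : V `<=` translate a (W :&: U)%VS.
  by move=> y Vy; rewrite /translate /= memv_cap; apply/andP; split;
    [exact: VW | exact: VU].
have le : (k <= \dim (W :&: U)%VS)%N by apply: kmin; apply/asboolP; exists (W :&: U)%VS.
have /eqP eW : (W :&: U == W)%VS by rewrite eqEdim capvSl /= dW.
by move: Wx; rewrite /translate /= -eW memv_cap => /andP[].
Qed.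

Lemma adim_le V a W : V `<=` translate a W -> (adim V <= \dim W)%N.
Proof.
move=> VW; have [->|/set0P V0] := eqVneq V set0; last first.
  have [b [U e]] := affine_hull_affine V0.
  rewrite /adim e direction_translate; apply: dimvS.
  have hs : affine_hull V `<=` translate a W.
    by move=> x; apply; split=> //; exists a, W.
  rewrite e in hs.
  have hb : translate a W b by apply: hs; rewrite /translate /= subrr rpred0.
  rewrite (translate_mem hb) in hs.
  apply/subvP => w Uw.
  by have := hs (w + b); rewrite /translate /= addrK; apply.
rewrite /adim /direction.
case: xgetP => [U _ [b e]|_]; last by rewrite dimv0.
have hU x c : translate b U x -> x = c.
  rewrite -e => /(_ (translate c 0%VS)) h.
  have : translate c 0%VS x by apply: h; split=> //; exists c, 0%VS.
  by rewrite /translate /= memv0 subr_eq0 => /eqP.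
have -> : U = 0%VS; last by rewrite dimv0.
apply/eqP; rewrite -subv0; apply/subvP => w Uw; rewrite memv0.
by rewrite -(inj_eq (addIr b)) add0r; apply/eqP/hU; rewrite /translate /= addrK.
Qed.

End AffineFacts.

(* Main.v *)
Require Import Defs.
From mathcomp Require Import all_boot all_order all_algebra.
From mathcomp Require Import boolp classical_sets cardinality reals.
From mathcomp Require Import complex.
From mathcomp Require Import ring zify.

(** Homogenize the points, so that lines become planes through the origin and affine dimension is
    bounded by linear dimension. Let [K] be a subspace, [a] the colour with the most points
    outside [K], and [L = K + span V_a]. Among the subspaces [K <= H < L], choose one minimizing
    the ratio of the number of points in [L \ H] to the codimension [e] of [H] in [L]. Then the
    [n] images [x_i] in [L / H] of the points of [L \ H] are semistable: a subspace of dimension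
    [r] contains at most [n r / e] of them. Hence there is an inner product for which they are
    nearly isotropic, so that the sum of [cos^2(x_i, x_j)] over all pairs is [O(n^2 / e)]. On the
    other hand, two points of the same colour are either identified in [L / H] or lie on a line
    with a third point, and three vectors in a plane cannot be almost orthogonal. As a third of
    all pairs have the same colour, the sum is at least a constant times [n^2], and so [e] is
    bounded. Finally [H] misses some point [v] of colour [a], and the lines joining [v] to the
    points of colour [a] in [H] contain distinct points outside [H]; so [n] is at least a sixth of
    the number of points in [L \ K], and the minimality of the ratio gives [dim L - dim K <= 6
    e]. Three such steps exhaust the colours. *)

Set Implicit Arguments.
Unset Strict Implicit.
Unset Printing Implicit Defensive.
Import Order.TTheory GRing.Theory Num.Theory.
Local Open Scope ring_scope.
Local Open Scope sesquilinear_scope.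

(** * Weighted Gram matrices *)

(** Matrix determinant lemma: one bordered matrix is factored through the Schur complement of each
    of its two diagonal blocks. *)
Lemma det_rank1_update (F : fieldType) e (M : 'M[F]_e) (u : 'cV_e) (v : 'rV_e) :
  M \in unitmx ->
  \det (M + u *m v) = \det M * (1 + (v *m invmx M *m u) 0 0).
Proof.
move=> Mu.
have e1 : block_mx M (- u) v 1%:M = block_mx (M + u *m v) (- u) 0 1%:M *m block_mx 1%:M 0 v 1%:M.
  by rewrite mulmx_block ?mulmx1 ?mul0mx ?mulmx0 ?mul1mx ?addr0 ?add0r mulNmx addrK.
have e2 : block_mx M (- u) v 1%:M =
  block_mx 1%:M 0 (v *m invmx M) 1%:M *m block_mx M (- u) 0 (1%:M + v *m invmx M *m u).
  rewrite mulmx_block ?mulmx1 ?mul0mx ?mulmx0 ?mul1mx ?addr0 ?add0r mulmxKV //.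
  by rewrite mulmxN addrC addrK.
have := e1; rewrite e2 => /(congr1 determinant).
rewrite !det_mulmx !det_ublock !det_lblock !det1 !mul1r !mulr1 => <-.
by rewrite det_mx11 !mxE.
Qed.
Section PositiveDefinite.
Variable C : numClosedFieldType.

Definition posdef e (M : 'M[C]_e) :=
  M^t* = M /\ forall z : 'rV[C]_e, z != 0 -> 0 < (z *m M *m z^t*) 0 0.

Lemma trmxC_mul m n p (A : 'M[C]_(m, n)) (B : 'M[C]_(n, p)) :
  (A *m B)^t* = B^t* *m A^t*.
Proof. by rewrite trmx_mul map_mxM. Qed.

Lemma mulmx_trmxC_ge0 e (z : 'rV[C]_e) : 0 <= (z *m z^t*) 0 0.
Proof. by rewrite mxE sumr_ge0 // => i _; rewrite !mxE mul_conjC_ge0. Qed.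

Lemma mulmx_trmxC_eq0 e (z : 'rV[C]_e) : (z *m z^t*) 0 0 = 0 -> z = 0.
Proof.
rewrite mxE => h; apply/rowP => i; rewrite mxE.
apply/eqP; rewrite -mul_conjC_eq0; apply/eqP.
have := psumr_eq0P _ h => /(_ _ i isT); rewrite !mxE; apply.
by move=> j _; rewrite !mxE mul_conjC_ge0.
Qed.

Lemma posdef_unit e (M : 'M[C]_e) : posdef M -> M \in unitmx.
Proof.
move=> [_ pM]; rewrite -row_free_unit -kermx_eq0; apply/eqP/row_matrixP => i.
rewrite row0; apply: contraTeq isT => /pM.
by rewrite -row_mul mulmx_ker row0 mul0mx mxE ltxx.
Qed.

Lemma posdef_inv_ge0 e (M : 'M[C]_e) (y : 'rV_e) :
  posdef M -> 0 <= (y *m invmx M *m y^t*) 0 0.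
Proof.
move=> hM; have Mu := posdef_unit hM; case: (hM) => hH pM.
set w := y *m invmx M; have yE : y = w *m M by rewrite mulmxKV.
rewrite yE trmxC_mul hH mulmxA; have [->|/pM/ltW//] := eqVneq w 0.
by rewrite !mul0mx mxE.
Qed.

Lemma posdefD e (M : 'M[C]_e) (s : C) (y : 'rV_e) :
  0 <= s -> posdef M -> posdef (M + s *: (y^t* *m y)).
Proof.
move=> s0 [hH pM]; split.
  rewrite linearD map_mxD hH linearZ map_mxZ /= conj_Creal ?ger0_real //.
  by rewrite -[in RHS](trmxCK y) -trmxC_mul !trmxCK.
move=> z /pM z0; rewrite mulmxDr mulmxDl [X in _ < X]mxE ltr_wpDr //.
rewrite -scalemxAr -scalemxAl mxE mulr_ge0 //.
have -> : z *m (y^t* *m y) *m z^t* = (z *m y^t*) *m (z *m y^t*)^t*.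
  by rewrite trmxC_mul trmxCK !mulmxA.
exact: mulmx_trmxC_ge0.
Qed.

Lemma det_posdefD e (M : 'M[C]_e) (s : C) (y : 'rV_e) : posdef M ->
  \det (M + s *: (y^t* *m y)) = \det M * (1 + s * (y *m invmx M *m y^t*) 0 0).
Proof.
move=> hM; rewrite scalemxAl det_rank1_update ?posdef_unit //.
by rewrite -scalemxAr mxE.
Qed.

Definition gramian n e (Y : 'M[C]_(n, e)) (s : 'I_n -> C) : 'M[C]_e :=
  \sum_i s i *: ((row i Y)^t* *m row i Y).

Lemma gramianE n e (Y : 'M[C]_(n, e)) (s : 'I_n -> C) :
  gramian Y s = Y^t* *m diag_mx (\row_i s i) *m Y.
Proof.
apply/matrixP => j k; rewrite /gramian summxE mul_mx_diag [RHS]mxE; apply: eq_bigr => i _.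
by rewrite !mxE big_ord1 !mxE; ring.
Qed.

Lemma gramian_square_posdef e (Y : 'M[C]_e) (s : 'I_e -> C) :
  (forall i, 0 < s i) -> Y \in unitmx -> 
  posdef (gramian Y s) /\ \det (gramian Y s) = `|\det Y| ^+ 2 * \prod_i s i.
Proof.
move=> s0 uY; split; last first.
  rewrite gramianE !det_mulmx det_diag det_map_mx det_tr normCK.
  rewrite (eq_bigr s) => [|i _]; [ring | by rewrite mxE].
split.
  rewrite gramianE !trmxC_mul trmxCK mulmxA; congr (_ *m _ *m _).
  rewrite tr_diag_mx map_diag_mx; congr diag_mx; apply/rowP => i.
  by rewrite !mxE; apply: conj_Creal; rewrite ger0_real ?ltW.
move=> z z0; rewrite gramianE !mulmxA -mulmxA.
set w := z *m _.
have -> : Y *m z^t* = w^t* by rewrite trmxC_mul trmxCK.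
have w0 : w != 0.
  apply: contraNneq z0 => w0.
  have := congr1 (mulmxr (invmx (Y^t*))) w0; rewrite /= mul0mx /w mulmxK => [->//|].
  by rewrite map_unitmx unitmx_tr.
rewrite mul_mx_diag mxE.
have wE j : (\matrix_(i, j) (w i j * (\row_k s k) 0 j)) 0 j * w^t* j 0 = s j * `|w 0 j| ^+ 2.
  by rewrite normCK !mxE; ring.
rewrite (eq_bigr _ (fun j _ => wE j)).
have /rV0Pn[i wi] := w0.
rewrite (bigD1 i) //= ltr_wpDr //.
  by apply: sumr_ge0 => j _; rewrite mulr_ge0 ?exprn_ge0 ?(ltW (s0 _)).
by rewrite mulr_gt0 // exprn_gt0 // normr_gt0.
Qed.

(* Adding the rank one terms outside the basis one at a time only increases the determinant. *)
Lemma gramian_posdef n e (Y : 'M[C]_(n, e)) (s : 'I_n -> C) (t : 'I_e -> 'I_n) :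
  (forall i, 0 < s i) -> injective t -> \det (rowsub t Y) != 0 ->
  posdef (gramian Y s) /\
  `|\det (rowsub t Y)| ^+ 2 * \prod_i s (t i) <= \det (gramian Y s).
Proof.
move=> s0 tI uY.
have [pB dB] : posdef (gramian (rowsub t Y) (s \o t)) /\
   \det (gramian (rowsub t Y) (s \o t)) = `|\det (rowsub t Y)| ^+ 2 * \prod_i s (t i).
  by apply: gramian_square_posdef => [j|]; [exact: s0 | rewrite unitmxE unitfE].
have -> : gramian Y s = gramian (rowsub t Y) (s \o t) +
    \sum_(i <- [seq i <- enum 'I_n | i \notin codom t]) s i *: ((row i Y)^t* *m row i Y).
  rewrite /gramian (bigID (mem (codom t))) /=; congr (_ + _); last first.
    by rewrite big_filter big_enum_cond.
  have -> : \sum_(i in codom t) s i *: ((row i Y)^t* *m row i Y) =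
     \sum_(i <- codom t) s i *: ((row i Y)^t* *m row i Y).
    by rewrite -big_uniq // /codom map_inj_uniq // enum_uniq.
  rewrite big_map big_enum /=; apply: eq_bigr => j _.
  by rewrite row_rowsub.
rewrite -dB; elim: [seq _ <- _ | _] => [|i l [IH1 IH2]]; first by rewrite big_nil addr0.
rewrite big_cons addrCA addrC; split; first by apply: posdefD; rewrite ?ltW.
rewrite det_posdefD // (le_trans IH2) // ler_peMr //.
  apply: le_trans IH2; rewrite dB mulr_ge0 ?exprn_ge0 //.
  by apply: prodr_ge0 => j _; exact/ltW.
by rewrite lerDl mulr_ge0 ?posdef_inv_ge0 ?(ltW (s0 _)).
Qed.
End PositiveDefinite.

(** * Elementary inequalities *)

Lemma bernoulli (R : numDomainType) (x : R) n :
  -1 <= x -> 1 + n%:R * x <= (1 + x) ^+ n.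
Proof.
move=> x1; have x0 : 0 <= 1 + x by rewrite -lerBlDl sub0r.
elim: n => [|n IH]; first by rewrite mul0r addr0.
rewrite exprS (le_trans _ (ler_wpM2l x0 IH)) // -subr_ge0.
have -> : (1 + x) * (1 + n%:R * x) - (1 + n.+1%:R * x) = n%:R * (x * x).
  by rewrite -natr1; ring.
rewrite mulr_ge0 ?ler0n // -expr2 real_exprn_even_ge0 //.
by rewrite -(addKr 1 x) realD ?realN ?real1 ?ger0_real.
Qed.

(** With [y = 1 / 3n], Bernoulli gives [(1 - y) ^+ n >= 2 / 3], hence [(1 + y) ^+ n <= 3 / 2], and
    also [1 + x <= 1 + e * y <= (1 + y) ^+ e]; the latter is raised to the power [n]. *)
Lemma expr_1D_le (R : numFieldType) (x : R) n e : (0 < n)%N -> 0 <= x ->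
  3 * n%:R * x <= e%:R -> (1 + x) ^+ n <= (3 / 2) ^+ e.
Proof.
move=> n0 x0 hx; pose y : R := (3 * n%:R)^-1.
have n0' : (0 : R) < n%:R by rewrite ltr0n.
have y0 : 0 < y by rewrite invr_gt0 mulr_gt0 ?ltr0n.
have ny : n%:R * y = 3^-1 by rewrite /y; field; rewrite gt_eqF.
have xy : x <= e%:R * y by rewrite ler_pdivlMr ?mulr_gt0 ?ltr0n // mulrC.
have y1 : y <= 1.
  rewrite invf_le1 ?mulr_gt0 ?ltr0n // -natrM ler1n; lia.
have h1 : (1 + y) ^+ n <= 3 / 2.
  have h2 : 2 / 3 <= (1 - y) ^+ n.
    apply: le_trans (bernoulli n _); last by rewrite lerN2.
    rewrite mulrN ny; have -> : (2 / 3 : R) = 1 - 3^-1 by field.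
    by [].
  have h3 : (1 + y) ^+ n * (1 - y) ^+ n <= 1.
    rewrite -exprMn exprn_ile1 //.
      by rewrite mulr_ge0 ?subr_ge0 // addr_ge0 ?ltW.
    have -> : (1 + y) * (1 - y) = 1 - y * y by ring.
    by rewrite gerBl mulr_ge0 ?ltW.
  have p0 : 0 <= (1 + y) ^+ n by rewrite exprn_ge0 // addr_ge0 ?ltW.
  have h4 := le_trans (ler_wpM2l p0 h2) h3.
  have -> : (1 + y) ^+ n = ((1 + y) ^+ n * (2 / 3)) * (3 / 2) by field.
  by rewrite ler_piMl ?divr_ge0 ?ler0n.
have h5 : 1 + x <= (1 + y) ^+ e.
  apply: le_trans (bernoulli e _); first by rewrite lerD2l.
  by apply: le_trans (ltW y0); rewrite oppr_le0.
apply: le_trans (lerXn2r n _ _ h5) _; rewrite ?nnegrE ?addr_ge0 ?exprn_ge0 ?addr_ge0 ?(ltW y0) //.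
by rewrite exprAC lerXn2r ?nnegrE ?exprn_ge0 ?addr_ge0 ?(ltW y0) ?divr_ge0 ?ler0n.
Qed.

(** * Bases of large weight *)

Lemma exists_min_real (R : numDomainType) (I : eqType) (s : I -> R) (l : seq I) :
  (forall i, s i \is Num.real) -> l != [::] ->
  exists2 i, i \in l & {in l, forall j, s i <= s j}.
Proof.
move=> sr; elim: l => // a [|b l] IH _.
  by exists a; rewrite ?mem_head // => j; rewrite inE => /eqP->.
have [//|i il h] := IH.
have [ai|ia] := real_leP (sr a) (sr i).
  exists a; rewrite ?mem_head // => j; rewrite inE => /predU1P[->//|/h].
  exact: le_trans.
exists i; first by rewrite in_cons il orbT.
by move=> j; rewrite inE => /predU1P[->|/h//]; exact: ltW.
Qed.

(* Matroid greedy algorithm: with [l] spanning a space of dimension [e] and [size l = n], the basis [b]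
   of largest weight satisfies [(prod_l s)^e <= (prod_b s)^n]. The lower bound [w] of the weights makes
   the induction on [l], by removal of the lightest element, go through. *)
Lemma greedy_basis (R : numDomainType) (F : fieldType) (vT : vectType F) (I : eqType)
    (x : I -> vT) (s : I -> R) (n e : nat) (l : seq I) (w : R) :
  (forall i, 0 < s i) ->
  (forall l, uniq l -> size l * e <= n * \dim <<[seq x i | i <- l]>>)%N ->
  uniq l -> 0 < w -> {in l, forall i, w <= s i} ->
  exists b : seq I, [/\ uniq b, free [seq x i | i <- b],
    (<<[seq x i | i <- b]>> = <<[seq x i | i <- l]>>)%VS &
    (\prod_(i <- l) s i) ^+ e * w ^+ (n * \dim <<[seq x i | i <- l]>> - size l * e)
      <= (\prod_(i <- b) s i) ^+ n].
Proof.
move=> s0 sz; move: {2}(size l) (erefl (size l)) => m.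
elim: m l w => [|m IH] l w ml ul w0 wl.
  move/eqP: ml; rewrite size_eq0 => /eqP->; exists [::].
  by split; rewrite ?nil_free //= span_nil dimv0 !big_nil !expr1n muln0 sub0n mulr1.
have sr i : s i \is Num.real by rewrite gtr0_real.
have l0 : l != [::] by rewrite -size_eq0 ml.
have [i il imin] := exists_min_real sr l0.
set l' := rem i l.
have ul' : uniq l' by rewrite rem_uniq.
have sl' : size l' = m by rewrite size_rem // ml.
have pl : perm_eq l (i :: l') by rewrite perm_to_rem.
have spl : (<<[seq x j | j <- l]>> = <[x i]> + <<[seq x j | j <- l']>>)%VS.
  by rewrite -span_cons; apply/eq_span/perm_mem; rewrite -map_cons perm_map.
have minl' : {in l', forall j, s i <= s j} by move=> j /mem_rem/imin.
have [b [ub fb sb hb]] := IH l' (s i) sl' ul' (s0 i) minl'.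
rewrite spl (perm_big _ pl) big_cons /= ml.
have wi : w <= s i by rewrite wl.
have P0 : 0 <= (\prod_(j <- l') s j) ^+ e.
  by rewrite exprn_ge0 // prodr_ge0 // => j _; exact: ltW.
have hs := sz l' ul'; have := sz l ul; rewrite spl ml => hs'.
rewrite sl' in hb hs.
(* If the lightest vector depends on the others it is discarded, otherwise it joins the basis.
   Either way [s i] is the lower bound for the rest, and the dimension hypothesis keeps the
   truncated subtractions in the exponents exact. *)
case: (boolP (x i \in <<[seq x j | j <- l']>>)%VS) => xi.
  have e1 : (<[x i]> + <<[seq x j | j <- l']>> = <<[seq x j | j <- l']>>)%VS.
    by apply/addv_idPr; rewrite -memvE.
  rewrite e1 in hs' *; exists b; split=> //.
  apply: le_trans hb; rewrite exprMn mulrAC mulrC ler_wpM2l //.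
  set d := \dim _ in hs hs' *.
  have -> : (n * d - m * e = e + (n * d - m.+1 * e))%N.
    by move: hs'; rewrite mulSn => hs'; rewrite addnBA // subnDl.
  by rewrite exprD ler_wpM2l ?exprn_ge0 ?(ltW (s0 _)) // lerXn2r ?nnegrE ?(ltW w0) ?(ltW (s0 _)).
have xi0 : x i != 0 by apply/eqP => xi0; rewrite xi0 mem0v in xi.
have dS : (\dim (<[x i]> + <<[seq x j | j <- l']>>) = (\dim <<[seq x j | j <- l']>>).+1)%N.
  rewrite dimv_disjoint_sum ?dim_vline ?xi0 ?add1n //.
  apply/eqP; rewrite -subv0; apply/subvP => v /memv_capP[/vlineP[k ->]].
  have [->|k0] := eqVneq k 0; first by rewrite scale0r !mem0v.
  by rewrite rpredZeq (negPf k0) (negPf xi).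
rewrite dS in hs' *.
have fib : free [seq x j | j <- i :: b] by rewrite /= free_cons sb xi.
exists (i :: b); split=> //.
- by rewrite /= ub andbT; move: (free_uniq fib) => /= /andP[+ _]; apply: contra; exact: map_f.
- by rewrite /= span_cons sb.
rewrite big_cons [X in _ <= X]exprMn; set d := \dim _ in hs hs' hb *.
apply: le_trans (ler_wpM2l (exprn_ge0 n (ltW (s0 i))) hb).
rewrite exprMn -mulrA mulrCA [X in _ <= X]mulrCA ler_wpM2l //.
rewrite -exprD; have -> : (n + (n * d - m * e) = e + (n * d.+1 - m.+1 * e))%N.
  by move: hs'; rewrite mulSn mulnS => hs'; rewrite !addnBA // subnDl.
by rewrite exprD ler_wpM2l ?exprn_ge0 ?(ltW (s0 _)) // lerXn2r ?nnegrE ?(ltW w0) ?(ltW (s0 _)).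
Qed.

(** * Near-isotropic position *)

Section BalancedWeights.
Variable C : numClosedFieldType.
Hypothesis archi : forall x : C, 0 <= x -> exists k : nat, x < k%:R.

(** The leverage score of statistics: the relative growth of the determinant of the Gram matrix when
    the weight [s i] is doubled. *)
Definition leverage n e (Y : 'M[C]_(n, e)) (s : 'I_n -> C) (i : 'I_n) : C :=
  s i * (row i Y *m invmx (gramian Y s) *m (row i Y)^t*) 0 0.

Lemma det_gramian_double n e (Y : 'M[C]_(n, e)) (s : 'I_n -> C) (i : 'I_n) :
  posdef (gramian Y s) ->
  \det (gramian Y [eta s with i |-> 2 * s i]) =
    \det (gramian Y s) * (1 + leverage Y s i).
Proof.
move=> pM; rewrite /leverage -det_posdefD //; congr (\det _).
rewrite /gramian (bigD1 i) //= [in RHS](bigD1 i) //= eqxx mulr_natl mulr2n scalerDl.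
rewrite -!addrA; congr (_ + _); rewrite addrC; congr (_ + _).
by apply: eq_bigr => j /negPf ->.
Qed.

Lemma prod_double n (s : 'I_n -> C) (i : 'I_n) :
  \prod_j [eta s with i |-> 2 * s i] j = 2 * \prod_j s j.
Proof.
rewrite (bigD1 i) //= [in RHS](bigD1 i) //= eqxx -mulrA; congr (_ * (_ * _)).
by apply: eq_bigr => j /negPf ->.
Qed.

(* While some leverage is below [e / 3n], doubling the weight of that row divides the potential
   [det ^ n / (prod s) ^ e] by at least [(4/3) ^ e]; the hypothesis bounds the potential below. *)
Lemma exists_balanced_weights n e (Y : 'M[C]_(n, e)) (c : C) :
  (0 < e)%N -> 0 < c ->
  (forall s, (forall i, 0 < s i) -> posdef (gramian Y s) /\
     c * (\prod_i s i) ^+ e <= (\det (gramian Y s)) ^+ n) ->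
  exists s : 'I_n -> C, (forall i, 0 < s i) /\
    forall i, e%:R <= 3 * n%:R * leverage Y s i.
Proof.
move=> e0 c0 hs; apply: contrapT => noex.
have bad s : (forall i, 0 < s i) -> exists i, 3 * n%:R * leverage Y s i <= e%:R.
  move=> s0; have [pM _] := hs s s0.
  have [h|/forallPn[i hi]] := boolP [forall i, e%:R <= 3 * n%:R * leverage Y s i].
    by case: noex; exists s; split=> // i; exact: (forallP h i).
  exists i; apply: ltW; rewrite real_ltNge ?realn // ger0_real //.
  by rewrite !mulr_ge0 ?ler0n ?posdef_inv_ge0 // (ltW (s0 i)).
pose one : 'I_n -> C := fun=> 1.
pose D := (\det (gramian Y one)) ^+ n.
(* Start from unit weights and double [k] times the weight of a row of small leverage. *)
have desc k : exists s : 'I_n -> C, (forall i, 0 < s i) /\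
    (4 / 3) ^+ k * (\det (gramian Y s)) ^+ n <= D * (\prod_i s i) ^+ e.
  elim: k => [|k [s [s0 IH]]].
    exists one; split; first by move=> i; exact: ltr01.
    by rewrite mul1r /one big1 // expr1n mulr1.
  have [i hi] := bad s s0; have [pM hM] := hs s s0.
  have l0 : 0 <= leverage Y s i.
    by rewrite mulr_ge0 ?posdef_inv_ge0 // (ltW (s0 i)).
  have n0 : (0 < n)%N by case: (n) i {hi l0} => [[]|].
  exists [eta s with i |-> 2 * s i]; split.
    by move=> j /=; case: eqP => // _; rewrite mulr_gt0 ?ltr0n.
  rewrite det_gramian_double // prod_double [(\det _ * _) ^+ n]exprMn [(2 * _) ^+ e]exprMn exprS.
  have P0 : 0 < (\prod_j s j) ^+ e by rewrite exprn_gt0 // prodr_gt0.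
  have M0 : 0 <= \det (gramian Y s) ^+ n.
    by apply: le_trans hM; rewrite mulr_ge0 // ltW.
  have h := expr_1D_le n0 l0 hi.
  have D0 : 0 <= D * (\prod_j s j) ^+ e.
    by apply: le_trans IH; rewrite mulr_ge0 // exprn_ge0 ?divr_ge0 ?ler0n.
  have x0 : 0 <= (1 + leverage Y s i) ^+ n by rewrite exprn_ge0 ?addr_ge0.
  apply: (@le_trans _ _ (4 / 3 * (D * (\prod_j s j) ^+ e * (3 / 2) ^+ e))).
    rewrite -[X in X <= _]mulrA [X in _ * X <= _]mulrA ler_wpM2l ?divr_ge0 ?ler0n //.
    by rewrite ler_pM // mulr_ge0 // exprn_ge0 ?divr_ge0 ?ler0n.
  (* Doubling multiplies [(\prod_j s j) ^+ e] by [2 ^+ e] but the power of the determinant by at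
     most [(3 / 2) ^+ e]. Of the gain [(4 / 3) ^+ e] a single factor is kept, as [0 < e]. *)
  have -> : (2 : C) ^+ e = (4 / 3) ^+ e * (3 / 2) ^+ e by rewrite -exprMn; congr (_ ^+ _); field.
  have -> : 4 / 3 * (D * (\prod_j s j) ^+ e * (3 / 2) ^+ e) =
            D * (\prod_j s j) ^+ e * (3 / 2) ^+ e * (4 / 3) by rewrite mulrC.
  have -> : D * ((4 / 3) ^+ e * (3 / 2) ^+ e * (\prod_j s j) ^+ e) =
            D * (\prod_j s j) ^+ e * (3 / 2) ^+ e * (4 / 3) ^+ e.
    by rewrite -!mulrA; congr (_ * _); rewrite mulrC -mulrA mulrCA.
  rewrite ler_wpM2l //; first by rewrite mulr_ge0 // exprn_ge0 ?divr_ge0 ?ler0n.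
  rewrite ler_eXnr //.
  by rewrite ler_pdivlMr ?ltr0n // mul1r ler_nat.
have D0 : 0 <= D.
  have [_ hM] := hs one (fun=> ltr01).
  by apply: le_trans hM; rewrite mulr_ge0 ?(ltW c0) // exprn_ge0 // prodr_ge0 // => *; exact: ler01.
(* For this [k], [(4 / 3) ^+ k >= 1 + k / 3] exceeds [D / c], against the lower bound in [hs]. *)
have [|k hk] := @archi (3 * D / c); first by rewrite divr_ge0 ?mulr_ge0 ?ler0n ?(ltW c0).
have [s [s0 hk']] := desc k; have [_ hM] := hs s s0.
have P0 : 0 < (\prod_j s j) ^+ e by rewrite exprn_gt0 // prodr_gt0.
have : (4 / 3) ^+ k * c <= D.
  rewrite -(ler_pM2r P0) -mulrA; apply: le_trans hk'.
  by rewrite ler_wpM2l ?exprn_ge0 ?divr_ge0 ?ler0n.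
apply/negP; rewrite -real_ltNge ?ger0_real //; last first.
  by rewrite mulr_ge0 ?(ltW c0) // exprn_ge0 ?divr_ge0 ?ler0n.
have b : 1 + k%:R * (1 / 3) <= (4 / 3 : C) ^+ k.
  have -> : (4 / 3 : C) = 1 + 1 / 3 by field.
  by apply: bernoulli; rewrite (@le_trans _ _ 0) ?oppr_le0 ?divr_ge0 ?ler0n.
apply: lt_le_trans (ler_wpM2r (ltW c0) b).
move: hk; rewrite ltr_pdivrMr // => hk.
rewrite -(@ltr_pM2l _ 3) ?ltr0n // (lt_trans hk) //.
have -> : 3 * ((1 + k%:R * (1 / 3)) * c) = k%:R * c + 3 * c by field.
by rewrite ltrDl mulr_gt0 ?ltr0n.
Qed.

(** [N] is the matrix of inner products of the [x i] for the form given by the inverse of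
    [M = gramian Y s], with balanced weights [s]. If [S] is the diagonal matrix of weights, then
    [N S N = N] and [N S] has trace [e], so the terms [s i * s j * |N i j|^2] add up to [e]; balance
    says [s i * N i i >= e / 3n]. *)
Lemma exists_isotropic_gram (vT : vectType C) n e (x : 'I_n -> vT) :
  \dim <<[seq x i | i <- enum 'I_n]>> = e -> (0 < e)%N ->
  (forall l, uniq l -> size l * e <= n * \dim <<[seq x i | i <- l]>>)%N ->
  exists N : 'M[C]_n, [/\ N^t* = N, forall i, 0 < N i i,
    forall a : 'rV_n, \sum_i a 0 i *: x i = 0 -> a *m N = 0 &
    (\sum_i \sum_j `|N i j| ^+ 2 / (N i i * N j j)) * e%:R <= 9 * n%:R ^+ 2].
Proof.
move=> eE; subst e; set E := <<_>>%VS => e0 hl; set e := \dim E in e0 hl *.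
have n0 : (0 < n)%N.
  rewrite lt0n; apply: contraTneq e0 => n0.
  by rewrite /e /E (size0nil (s := enum 'I_n)) ?size_enum_ord // span_nil dimv0.
pose Y : 'M[C]_(n, e) := \matrix_(i, j) coord (vbasis E) j (x i).
have xE i : x i \in E by rewrite memv_span // map_f // mem_enum.
have YE (m : nat) (a : 'rV_m) (f : 'I_m -> 'I_n) :
    a *m rowsub f Y = 0 <-> \sum_i a 0 i *: x (f i) = 0.
  have xfE i : x (f i) = \sum_j Y (f i) j *: (vbasis E)`_j.
    by rewrite {1}(coord_vbasis (xE (f i))); apply: eq_bigr => j _; rewrite mxE.
  have -> : \sum_i a 0 i *: x (f i) = \sum_j (a *m rowsub f Y) 0 j *: (vbasis E)`_j.
    under eq_bigr do rewrite xfE scaler_sumr.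
    rewrite exchange_big; apply: eq_bigr => j _; rewrite mxE scaler_suml.
    by apply: eq_bigr => i _; rewrite scalerA [rowsub f Y i j]mxE.
  split=> [->|h]; first by rewrite big1 // => j _; rewrite mxE scale0r.
  apply/rowP => j; rewrite [RHS]mxE.
  have /freeP fE := basis_free (vbasisP E); exact: (fE (fun j => (a *m rowsub f Y) 0 j)).
(* A positive lower bound for all nonzero squared maximal minors of [Y]; the vanishing minors
   contribute [0^-1 = 0] to the sum. *)
pose c : C := (1 + \sum_(t : {ffun 'I_e -> 'I_n}) (`|\det (rowsub t Y)| ^+ 2)^-1)^-1.
have S0 (P : pred {ffun 'I_e -> 'I_n}) :
    0 <= \sum_(t | P t) (`|\det (rowsub t Y)| ^+ 2)^-1.
  by apply: sumr_ge0 => t _; rewrite invr_ge0 exprn_ge0.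
have c0 : 0 < c by rewrite invr_gt0 ltr_pwDl.
have hc (t : {ffun 'I_e -> 'I_n}) : \det (rowsub t Y) != 0 -> c <= `|\det (rowsub t Y)| ^+ 2.
  move=> dt; have d0 : 0 < `|\det (rowsub t Y)| ^+ 2 by rewrite exprn_gt0 // normr_gt0.
  rewrite -[X in _ <= X]invrK lef_pV2 ?posrE ?invr_gt0 // ?ltr_pwDl //.
  by rewrite (bigD1 t) //= addrCA lerDl addr_ge0.
have hs (s : 'I_n -> C) : (forall i, 0 < s i) -> posdef (gramian Y s) /\
    c ^+ n * (\prod_i s i) ^+ e <= (\det (gramian Y s)) ^+ n.
  move=> s0.
  have sr i : s i \is Num.real by rewrite gtr0_real.
  have en0 : enum 'I_n != [::] by rewrite -size_eq0 size_enum_ord -lt0n.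
  have [w _ hw] := exists_min_real sr en0.
  have [b [ub fb sb]] := greedy_basis s0 hl (enum_uniq _) (s0 w) hw.
  (* For the whole family the exponent [n * e - n * e] of the lower bound [w] vanishes. *)
  rewrite size_enum_ord -/E -/e subnn mulr1 big_enum /= => hb.
  have szb : size b == e by rewrite -(size_map x) eq_sym /e /E -sb; exact: fb.
  pose t := [ffun j => tnth (Tuple szb) j].
  have tI : injective t.
    by move=> j k; rewrite !ffunE; apply/tuple_uniqP.
  have dt : \det (rowsub t Y) != 0.
    rewrite -unitfE -unitmxE -row_free_unit -kermx_eq0; apply/eqP/row_matrixP => i.
    rewrite row0; set a := row i _.
    have : a *m rowsub t Y = 0 by rewrite -row_mul mulmx_ker row0.
    move/YE => h; apply/rowP => j; rewrite [RHS]mxE.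
    have ft : free (map_tuple x (Tuple szb)) by [].
    move/freeP: ft; apply; rewrite -{}[RHS]h; apply: eq_bigr => k _.
    by rewrite -tnth_nth tnth_map ffunE.
  have [pM hM] := gramian_posdef s0 tI dt; split=> //.
  have bE : \prod_(i <- b) s i = \prod_j s (t j).
    rewrite -[b]/(tval (Tuple szb)) big_tuple.
    by apply: eq_bigr => j _; rewrite ffunE.
  rewrite bE in hb; have p0 : 0 <= \prod_j s (t j).
    by apply: prodr_ge0 => j _; exact: ltW.
  apply: le_trans (ler_wpM2l _ hb) _; first by rewrite exprn_ge0 // ltW.
  have h0 : 0 <= c * \prod_j s (t j) by rewrite mulr_ge0 // ltW.
  have h1 : c * \prod_j s (t j) <= \det (gramian Y s).
    by apply: le_trans hM; rewrite ler_wpM2r // hc.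
  by rewrite -exprMn lerXn2r ?nnegrE // (le_trans h0).
have [s [s0 lev]] := exists_balanced_weights e0 (exprn_gt0 n c0) hs.
have [pM _] := hs s s0; have Mu := posdef_unit pM.
set M := gramian Y s in pM Mu.
pose N := Y *m invmx M *m Y^t*.
have NH : N^t* = N.
  rewrite /N !trmxC_mul trmxCK trmx_inv map_invmx pM.1 mulmxA //.
have NHE i j : N j i = (N i j)^* by rewrite -[in LHS]NH !mxE.
have levE i : leverage Y s i = s i * N i i.
  rewrite /leverage -/M /N; congr (_ * _); rewrite -row_mul [LHS]mxE [RHS]mxE.
  by apply: eq_bigr => k _; rewrite !mxE.
have n0' : (0 : C) < n%:R by rewrite ltr0n.
have N0 i : 0 < N i i.
  have : 0 < 3 * n%:R * (s i * N i i) by rewrite -levE (lt_le_trans _ (lev i)) // ltr0n.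
  by rewrite !pmulr_rgt0 ?ltr0n.
exists N; split=> //.
  move=> a h; rewrite /N !mulmxA.
  have /YE : \sum_i a 0 i *: x (id i) = 0 by [].
  by rewrite mxsub_id => ->; rewrite !mul0mx.
have GE : M = Y^t* *m diag_mx (\row_i s i) *m Y by exact: gramianE.
have NSN : N *m diag_mx (\row_i s i) *m N = N.
  by rewrite {3}/N -[in RHS](mulmxK Mu (Y *m invmx M)) /N GE !mulmxA.
have trN : \sum_i s i * N i i = e%:R.
  rewrite -(mxtrace1 C e) -(mulVmx Mu) {2}GE !mulmxA mxtrace_mulC !mulmxA -/N.
  by rewrite mul_mx_diag; apply: eq_bigr => i _; rewrite !mxE mulrC.
have sumN : \sum_i \sum_j s i * s j * `|N i j| ^+ 2 = e%:R.
  rewrite -trN; apply: eq_bigr => i _; rewrite -[in RHS]NSN mul_mx_diag mxE mulr_sumr.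
  by apply: eq_bigr => j _; rewrite normCK (NHE i j) !mxE; ring.
have e0' : (0 : C) < e%:R by rewrite ltr0n.
(* After multiplication by [e], the right-hand [e] is expanded by [sumN] and the sums are compared
   term by term. *)
rewrite -(ler_pM2r e0') -{3}sumN -mulrA !mulr_sumr mulr_suml.
apply: ler_sum => i _; rewrite mulr_sumr mulr_suml; apply: ler_sum => j _.
rewrite mulrAC ler_pdivrMr ?mulr_gt0 //.
have -> : 9 * n%:R ^+ 2 * (s i * s j * `|N i j| ^+ 2) * (N i i * N j j) =
  `|N i j| ^+ 2 * ((3 * n%:R * leverage Y s i) * (3 * n%:R * leverage Y s j)).
  by rewrite !levE; ring.
by rewrite ler_wpM2l ?exprn_ge0 // ler_pM ?ler0n.
Qed.

End BalancedWeights.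

(** * Angles between vectors of a plane *)

Section Angles.
Variable C : numClosedFieldType.

Definition cos2 n (N : 'M[C]_n) i j : C := `|N i j| ^+ 2 / (N i i * N j j).

Lemma cos2_ge0 n (N : 'M[C]_n) i j : (forall i, 0 < N i i) -> 0 <= cos2 N i j.
Proof. by move=> N0; rewrite divr_ge0 ?exprn_ge0 ?mulr_ge0 ?(ltW (N0 _)). Qed.

Lemma cos2_sym n (N : 'M[C]_n) i j : N^t* = N -> cos2 N i j = cos2 N j i.
Proof.
move=> NH; rewrite /cos2 [N j j * _]mulrC; congr (_ ^+ 2 / _).
by rewrite -[in LHS]NH !mxE norm_conjC.
Qed.

Lemma cos2_diag n (N : 'M[C]_n) i : (forall i, 0 < N i i) -> cos2 N i i = 1.
Proof.
move=> N0; rewrite /cos2 gtr0_norm // expr2 divff // mulf_neq0 // gt_eqF //.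
Qed.

(* Pair the relation with the vector carrying its longest term. *)
Lemma cos2_dependent_max n (N : 'M[C]_n) i j k (a b g : C) :
  N^t* = N -> (forall i, 0 < N i i) -> a != 0 ->
  `|b| ^+ 2 * N j j <= `|a| ^+ 2 * N i i -> `|g| ^+ 2 * N k k <= `|a| ^+ 2 * N i i ->
  a * N i i + b * N j i + g * N k i = 0 -> 1 / 2 <= cos2 N i j + cos2 N i k.
Proof.
move=> NH N0 a0 hb hg h; pose A := `|a| * N i i.
have A0 : 0 < A by rewrite mulr_gt0 ?normr_gt0.
have key m (y : C) : `|y| ^+ 2 * N m m <= `|a| ^+ 2 * N i i ->
    (`|y| * `|N m i|) ^+ 2 <= cos2 N i m * A ^+ 2.
  move=> hy; rewrite (cos2_sym _ _ NH) /cos2.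
  have -> : `|N m i| ^+ 2 / (N m m * N i i) * A ^+ 2 =
     `|N m i| ^+ 2 / N m m * (`|a| ^+ 2 * N i i).
    by rewrite /A; field; rewrite !gt_eqF.
  have -> : (`|y| * `|N m i|) ^+ 2 = `|N m i| ^+ 2 / N m m * (`|y| ^+ 2 * N m m).
    by field; rewrite gt_eqF.
  by rewrite ler_wpM2l // divr_ge0 ?exprn_ge0 // ltW.
(* The triangle inequality in the relation; squaring the two-term sum then costs the factor 2. *)
have hA : A <= `|b| * `|N j i| + `|g| * `|N k i|.
  rewrite -!normrM (le_trans _ (ler_normD _ _)) // -normrN.
  have -> : - (b * N j i + g * N k i) = a * N i i.
    by apply/eqP; rewrite eq_sym -addr_eq0 addrA h.
  by rewrite normrM (gtr0_norm (N0 i)).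
set u := `|b| * `|N j i| in hA *; set v := `|g| * `|N k i| in hA *.
have u0 : 0 <= u by rewrite mulr_ge0. have v0 : 0 <= v by rewrite mulr_ge0.
have h1 : A ^+ 2 <= (u + v) ^+ 2 by rewrite lerXn2r // ?nnegrE ?addr_ge0 // ltW.
have h2 : (u + v) ^+ 2 <= 2 * (u ^+ 2 + v ^+ 2).
  have -> : 2 * (u ^+ 2 + v ^+ 2) = (u + v) ^+ 2 + (u - v) ^+ 2 by ring.
  by rewrite lerDl real_exprn_even_ge0 // realB ?ger0_real.
have h3 := le_trans h1 (le_trans h2 (ler_wpM2l (ler0n _ 2) (lerD (key j b hb) (key k g hg)))).
have A2 : 0 < A ^+ 2 by rewrite exprn_gt0.
rewrite ler_pdivrMr ?ltr0n // -(ler_pM2r A2) mul1r (le_trans h3) //.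
by rewrite -mulrDl mulrCA mulrA [_ * 2]mulrC.
Qed.

(** Whichever of the three terms is longest, [cos2_dependent_max] applied to its vector bounds a sum
    of two of the cosines, and the remaining one is nonnegative. *)
Lemma cos2_dependent n (N : 'M[C]_n) i j k (a b g : C) :
  N^t* = N -> (forall i, 0 < N i i) -> [|| a != 0, b != 0 | g != 0] ->
  (forall l, a * N i l + b * N j l + g * N k l = 0) ->
  1 / 2 <= cos2 N i j + cos2 N j k + cos2 N i k.
Proof.
move=> NH N0 nz h.
have nn (y : C) m : `|y| ^+ 2 * N m m \is Num.real.
  by rewrite ger0_real // mulr_ge0 ?exprn_ge0 // ltW.
have nz0 (y z : C) p q : `|z| ^+ 2 * N q q <= `|y| ^+ 2 * N p p -> z != 0 -> y != 0.
  move=> hz z0; apply: contraTneq hz => ->.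
  rewrite normr0 expr0n mul0r -real_ltNge ?real0 //.
  by rewrite mulr_gt0 // exprn_gt0 // normr_gt0.
have c0 p q := cos2_ge0 p q N0.
have max1 : `|b| ^+ 2 * N j j <= `|a| ^+ 2 * N i i -> `|g| ^+ 2 * N k k <= `|a| ^+ 2 * N i i ->
    1 / 2 <= cos2 N i j + cos2 N j k + cos2 N i k.
  move=> hb hg; have a0 : a != 0.
    by case/or3P: nz => //; [apply: (nz0 _ _ _ _ hb) | apply: (nz0 _ _ _ _ hg)].
  apply: le_trans (cos2_dependent_max NH N0 a0 hb hg (h i)) _.
  by rewrite addrAC lerDl.
have max2 : `|a| ^+ 2 * N i i <= `|b| ^+ 2 * N j j -> `|g| ^+ 2 * N k k <= `|b| ^+ 2 * N j j ->
    1 / 2 <= cos2 N i j + cos2 N j k + cos2 N i k.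
  move=> ha hg; have b0 : b != 0.
    by case/or3P: nz => //; [apply: (nz0 _ _ _ _ ha) | apply: (nz0 _ _ _ _ hg)].
  have hj : b * N j j + a * N i j + g * N k j = 0 by rewrite [b * _ + _]addrC.
  apply: le_trans (cos2_dependent_max NH N0 b0 ha hg hj) _.
  by rewrite [cos2 N j i]cos2_sym // lerDl.
have max3 : `|a| ^+ 2 * N i i <= `|g| ^+ 2 * N k k -> `|b| ^+ 2 * N j j <= `|g| ^+ 2 * N k k ->
    1 / 2 <= cos2 N i j + cos2 N j k + cos2 N i k.
  move=> ha hb; have g0 : g != 0.
    by case/or3P: nz => //; [apply: (nz0 _ _ _ _ ha) | apply: (nz0 _ _ _ _ hb)].
  have hk : g * N k k + a * N i k + b * N j k = 0 by rewrite -addrA addrC.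
  apply: le_trans (cos2_dependent_max NH N0 g0 ha hb hk) _.
  by rewrite [cos2 N k i]cos2_sym // [cos2 N k j]cos2_sym // -addrA [cos2 N j k + _]addrC lerDr.
have [hab|/ltW hba] := real_leP (nn a i) (nn b j).
  have [hbg|/ltW hgb] := real_leP (nn b j) (nn g k); first exact: max3 (le_trans hab hbg) hbg.
  exact: max2.
have [hag|/ltW hga] := real_leP (nn a i) (nn g k); first exact: max3 hag (le_trans hba hag).
exact: max1.
Qed.

Section Triples.
Variables (I : finType) (c : I -> I -> C) (T : I -> I -> I -> bool).
Hypothesis T_rot : forall i j k, T i j k -> T j k i.
Hypothesis T_swap : forall i j k, T i j k -> T i k j.
(** In the application [T] is collinearity of distinct points and, for distinct [i] and [j], [r i j]
    counts the further points on their line. This is why [r_rot] holds there. *)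
Let r i j := #|[pred k | T i j k]|.
Hypothesis r_rot : forall i j k, T i j k -> r i j = r j k.
Hypothesis cT : forall i j k, T i j k -> 1 / 2 <= c i j + c j k + c i k.

(* Each triple is counted with weight 1/r, where r is the number of ways of completing one of its
   pairs, so that every pair contained in a triple has total weight 1. *)
Lemma triples_average :
  \sum_i \sum_j (0 < r i j)%N%:R <= 6 * (\sum_i \sum_j (0 < r i j)%N%:R * c i j).
Proof.
have r_sym i j : r i j = r j i.
  by apply: eq_card => k; rewrite !inE; apply/idP/idP => /T_rot/T_swap.
pose W i j k : C := (T i j k)%:R / (r i j)%:R.
have W0 i j k : 0 <= W i j k by rewrite divr_ge0.
have rE i j : (0 < r i j)%N%:R = \sum_k W i j k.
  rewrite /W -mulr_suml -natr_sum.
  have -> : (\sum_k T i j k = r i j)%N.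
    rewrite /r -sum1_card [RHS]big_mkcond; apply: eq_bigr => k _.
    by rewrite !inE; case: (T _ _ _).
  by case: (r i j) => [|m]; rewrite ?mul0r // divff // pnatr_eq0.
have Wrot i j k : W i j k = W j k i.
  rewrite /W; have [t|t] := boolP (T i j k).
    by rewrite (T_rot t) (r_rot t).
  by rewrite (contraNF (@T_rot _ _ _ \o @T_rot _ _ _) t) !mul0r.
have Wsw i j k : W i j k = W i k j.
  rewrite /W; have [t|t] := boolP (T i j k).
    by rewrite (T_swap t) (r_rot t) (r_rot (T_rot t)) r_sym.
  by rewrite (contraNF (@T_swap _ _ _) t) !mul0r.
pose S := \sum_i \sum_j \sum_k W i j k * c i j.
have SE : \sum_i \sum_j (0 < r i j)%N%:R * c i j = S.
  by apply: eq_bigr => i _; apply: eq_bigr => j _; rewrite rE mulr_suml.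
have S2 : \sum_i \sum_j \sum_k W i j k * c j k = S.
  rewrite exchange_big; apply: eq_bigr => j _; rewrite exchange_big; apply: eq_bigr => k _.
  by apply: eq_bigr => i _; rewrite Wrot.
have S3 : \sum_i \sum_j \sum_k W i j k * c i k = S.
  apply: eq_bigr => i _; rewrite exchange_big; apply: eq_bigr => k _.
  by apply: eq_bigr => j _; rewrite Wsw.
have -> : 6 * (\sum_i \sum_j (0 < r i j)%N%:R * c i j) = 2 * (S + S + S) by rewrite SE; ring.
rewrite -{2}S2 -{2}S3 -!big_split mulr_sumr; apply: ler_sum => i _.
rewrite -!big_split mulr_sumr; apply: ler_sum => j _.
rewrite -!big_split mulr_sumr rE; apply: ler_sum => k _ /=.
rewrite -!mulrDr mulrCA; have [t|t] := boolP (T i j k).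
  by rewrite ler_peMr // -ler_pdivrMl ?ltr0n // mulrC; apply: cT.
by rewrite /W (negPf t) !mul0r.
Qed.
End Triples.
End Angles.

(** * Dimension bound for semistable families *)

Section SemistableFamilies.
Variable C : numClosedFieldType.

(** Proportional vectors have cosine one; the weaker constant comes from [cos2_dependent_max] with
    [k := j] and a vanishing third coefficient. *)
Lemma cos2_parallel n (N : 'M[C]_n) i j (a b : C) :
  N^t* = N -> (forall i, 0 < N i i) -> (a != 0) || (b != 0) ->
  (forall l, a * N i l + b * N j l = 0) -> 1 / 4 <= cos2 N i j.
Proof.
move=> NH N0; wlog hab : i j a b / `|b| ^+ 2 * N j j <= `|a| ^+ 2 * N i i.
  move=> W nz h.
  have nn (y : C) m : `|y| ^+ 2 * N m m \is Num.real.
    by rewrite ger0_real // mulr_ge0 ?exprn_ge0 // ltW.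
  have [/W->//|/ltW hba] := real_leP (nn b j) (nn a i).
  rewrite cos2_sym //; apply: (W _ _ _ _ hba); first by rewrite orbC.
  by move=> l; rewrite addrC.
move=> nz h; have a0 : a != 0.
  case/orP: nz => // b0; apply: contraTneq hab => ->.
  rewrite normr0 expr0n mul0r -real_ltNge ?real0 ?mulr_gt0 ?exprn_gt0 ?normr_gt0 //.
  by rewrite ger0_real // mulr_ge0 ?exprn_ge0 // ltW.
have := cos2_dependent_max NH N0 (k := j) (g := 0) a0 hab.
rewrite normr0 expr0n mul0r mulr_ge0 ?exprn_ge0 ?(ltW (N0 _)) //.
rewrite mul0r addr0 h => /(_ isT erefl).
rewrite -mulr2n -[cos2 N i j *+ 2]mulr_natr -ler_pdivrMr ?ltr0n // => le2.
by apply: le_trans le2; rewrite -mulrA -invfM -natrM.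
Qed.

(** Cauchy-Schwarz for the sizes of the three classes, whose squares add up to the number of pairs
    of one colour. *)
Lemma same_colour_pairs (I : finType) (col : I -> 'I_3) :
  (#|I| ^ 2 <= 3 * \sum_i \sum_j (col i == col j))%N.
Proof.
pose m a := (\sum_i (col i == a))%N.
have -> : (\sum_i \sum_j (col i == col j) = \sum_a m a * m a)%N.
  rewrite (partition_big col xpredT) //=; apply: eq_bigr => a _.
  rewrite {1}/m big_distrl /= big_mkcond /=; apply: eq_bigr => i _.
  case: eqP => [->|]; last by rewrite mul0n.
  by rewrite mul1n; apply: eq_bigr => j _; rewrite eq_sym.
have -> : #|I| = (\sum_a m a)%N.
  rewrite /m exchange_big /= -sum1_card; apply: eq_bigr => i _.
  rewrite (bigD1 (col i)) //= eqxx big1 // => a.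
  by rewrite eq_sym => /negPf->.
rewrite !big_ord_recl !big_ord0; move: (m _) (m _) (m _) => x y z.
have [h1 _] := nat_Cauchy x y; have [h2 _] := nat_Cauchy x z; have [h3 _] := nat_Cauchy y z.
by move: h1 h2 h3; rewrite -!mulnn; nia.
Qed.

Hypothesis archi : forall x : C, 0 <= x -> exists k : nat, x < k%:R.

(* 162 = 9 * 18: the sum of the [cos2] is at most [9 n^2 / e] and at least [n^2 / 18]. *)
Lemma semistable_dim_bound (vT : vectType C) n e (v : 'I_n -> vT) (f : 'End(vT))
    (col : 'I_n -> 'I_3) :
  (forall i j, i != j -> v j \notin <[v i]>%VS) ->
  (forall i j, i != j -> col i = col j ->
    (exists k, [/\ k != i, k != j & v k \in (<[v i]> + <[v j]>)%VS]) \/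
    (exists z, [/\ z != 0, f z = 0 & z \in (<[v i]> + <[v j]>)%VS])) ->
  \dim <<[seq f (v i) | i <- enum 'I_n]>> = e ->
  (forall l, uniq l -> size l * e <= n * \dim <<[seq f (v i) | i <- l]>>)%N ->
  (e <= 162)%N.
Proof.
move=> vI hcol he hl; have [->//|e0] := posnP e.
have n0 : (0 < n)%N.
  rewrite lt0n; apply: contraTneq e0 => n0.
  by rewrite -he (size0nil (s := enum 'I_n)) ?size_enum_ord // span_nil dimv0.
have [N [NH N0 Ndep Nsum]] := exists_isotropic_gram archi he e0 hl.
(* A linear relation among the images under [f] passes to the rows of [N]. *)
have Nd i j k a b g : a *: v i + b *: v j + g *: v k = 0 \/
      f (a *: v i + b *: v j + g *: v k) = 0 ->
    forall l, a * N i l + b * N j l + g * N k l = 0.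
  move=> h l; have {}h : f (a *: v i + b *: v j + g *: v k) = 0.
    by case: h => [->|//]; rewrite linear0.
  pose w : 'rV_n := a *: delta_mx 0 i + b *: delta_mx 0 j + g *: delta_mx 0 k.
  have wE (V : lmodType C) (F : 'I_n -> V) : \sum_m w 0 m *: F m = a *: F i + b *: F j + g *: F k.
    have dE y p : \sum_m (y * (m == p)%:R) *: F m = y *: F p.
      rewrite (bigD1 p) //= eqxx mulr1 big1 ?addr0 // => m /negPf->.
      by rewrite mulr0 scale0r.
    rewrite -!dE -!big_split; apply: eq_bigr => m _; rewrite !mxE eqxx /=.
    by rewrite !scalerDl.
  rewrite !linearD !linearZ in h.
  have /rowP/(_ l) : w *m N = 0 by apply: Ndep; rewrite (wE _ (f \o v)).
  by rewrite mxE [RHS]mxE => wN; rewrite -[RHS]wN; exact: esym (wE C^o (fun m => N m l)).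
(* Projective collinearity of three distinct points, before [f] is applied. *)
pose T i j k := [&& i != j, k != i, k != j & v k \in (<[v i]> + <[v j]>)%VS].
have T_sym i j k : T i j k -> T j i k.
  by rewrite /T addvC eq_sym => /and4P[-> -> -> ->].
have T_swap' i j k : T i j k -> T i k j /\ (<[v i]> + <[v j]> = <[v i]> + <[v k]>)%VS.
  move=> /and4P[ij ki kj].
  case/memv_addP => y /vlineP[a ->] [z /vlineP[b ->]] vk.
  have b0 : b != 0.
    apply/eqP => b0; have := vI i k; rewrite eq_sym ki => /(_ isT).
    by rewrite vk b0 scale0r addr0 memvZ // memv_line.
  have vj : v j = b^-1 *: v k - (b^-1 * a) *: v i.
    by rewrite vk scalerDr !scalerA mulVf // scale1r addrAC subrr add0r.
  have jik : v j \in (<[v i]> + <[v k]>)%VS.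
    by rewrite vj addrC memv_add // ?memvN memvZ // memv_line.
  have kij : v k \in (<[v i]> + <[v j]>)%VS.
    by rewrite vk memv_add // memvZ // memv_line.
  rewrite /T jik eq_sym ki [j == i]eq_sym ij [j == k]eq_sym kj; split=> //.
  by apply/eqP; rewrite eqEsubv !subv_add !addvSl -!memvE jik kij.
have T_swap i j k : T i j k -> T i k j by case/T_swap'.
have T_rot i j k : T i j k -> T j k i by move/T_sym/T_swap.
pose r i j := #|[pred k | T i j k]|.
have rE i j : i != j -> (r i j + 2 = #|[set k | v k \in (<[v i]> + <[v j]>)%VS]|)%N.
  move=> ij; rewrite (cardsD1 i) (cardsD1 j) !inE [j == i]eq_sym ij /=.
  rewrite (subvP (addvSl _ _)) ?memv_line // (subvP (addvSr _ _)) ?memv_line //.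
  rewrite addnA addnC; congr (_ + _)%N; rewrite -cardsE; apply: eq_card => k.
  by rewrite !inE /T ij /= andbCA.
have r_rot i j k : T i j k -> r i j = r j k.
  move=> t; have /and4P[ij ki kj _] := t.
  apply/eqP; rewrite -(eqn_add2r 2) !rE // 1?eq_sym //.
  by have [_ <-] := T_swap' _ _ _ (T_sym _ _ _ t); rewrite addvC.
have cT i j k : T i j k -> 1 / 2 <= cos2 N i j + cos2 N j k + cos2 N i k.
  move=> /and4P[ij ki kj].
  case/memv_addP => y /vlineP[a ->] [z /vlineP[b ->]] vk.
  apply: (@cos2_dependent _ _ _ _ _ _ a b (-1)) => //.
    by rewrite oppr_eq0 oner_eq0 !orbT.
  by apply: Nd; left; rewrite vk scaleN1r subrr.
have := triples_average T_rot T_swap r_rot cT => avg.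
(* A pair of one colour in no triple is diagonal or has dependent images under [f], so its [cos2] is
   at least 1/4. The factor 6, where 4 would do, matches [triples_average]. *)
have mono i j : (col i == col j)%:R <= (0 < r i j)%N%:R + 6 * ((r i j == 0%N)%:R * cos2 N i j).
  have c0 := cos2_ge0 i j N0.
  case: (posnP (r i j)) => [r0|r0]; rewrite ?mul0r ?mulr0 ?addr0 ?add0r ?mul1r; last first.
    by case: (_ == _); rewrite ?ler01.
  case: eqP => [cij|_]; last by rewrite mulr_ge0 ?ler0n.
  have [->|ij] := eqVneq i j; first by rewrite cos2_diag // mulr1 ler1n.
  have : 1 / 4 <= cos2 N i j.
    case: (hcol i j ij cij) => [[k [ki kj vk]]|[z [z0 fz]]].
      have : (0 < r i j)%N by apply/card_gt0P; exists k; rewrite inE /T ij ki kj.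
      by rewrite r0.
    case/memv_addP => y /vlineP[a ->] [y' /vlineP[b ->]] zE.
    apply: (@cos2_parallel _ _ _ _ a b) => //.
      apply: contraNT z0; rewrite negb_or !negbK zE => /andP[/eqP-> /eqP->].
      by rewrite !scale0r addr0.
    move=> l; have := Nd i j j a b 0; rewrite scale0r addr0 -zE fz.
    by move=> /(_ (or_intror erefl) l); rewrite mul0r addr0.
  rewrite ler_pdivrMr ?ltr0n // => h; apply: le_trans h _.
  by rewrite mulrC ler_wpM2r // ler_nat.
have S1 : (n ^ 2)%:R <= 18 * \sum_i \sum_j cos2 N i j.
  have := same_colour_pairs col; rewrite card_ord -(ler_nat C) => h.
  apply: le_trans h _; rewrite natrM natr_sum.
  have -> : (18 : C) = 3 * 6 by rewrite -natrM.
  rewrite -mulrA ler_wpM2l ?ler0n //.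
  apply: (@le_trans _ _ (\sum_i \sum_j (0 < r i j)%N%:R +
     6 * \sum_i \sum_j (r i j == 0%N)%:R * cos2 N i j)).
    rewrite mulr_sumr -big_split; apply: ler_sum => i _; rewrite natr_sum.
    by rewrite mulr_sumr -big_split; apply: ler_sum => j _; exact: mono.
  apply: le_trans (lerD avg (lexx _)) _.
  rewrite -mulrDr ler_wpM2l ?ler0n // -big_split ler_sum // => i _.
  rewrite -big_split ler_sum // => j _ /=.
  by rewrite -mulrDl lt0n; case: (r i j == 0%N); rewrite ?add0r ?addr0 mul1r.
have : (n ^ 2 * e)%:R <= (n ^ 2 * 162)%:R :> C.
  rewrite [X in X <= _]natrM; apply: le_trans (ler_wpM2r (ler0n _ _) S1) _.
  rewrite -[X in X <= _]mulrA; apply: le_trans (ler_wpM2l (ler0n _ _) Nsum) _.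
  by rewrite mulrA -natrX -!natrM mulnC.
by rewrite ler_nat leq_pmul2l // expn_gt0 n0.
Qed.
End SemistableFamilies.

(** * Three-coloured configurations *)

Section Quotients.
Variables (F : fieldType) (vT : vectType F).
Implicit Types (K L H U : {vspace vT}).

Lemma ltn_dimv H L : (H <= L)%VS -> H != L -> (\dim H < \dim L)%N.
Proof.
move=> HL nHL; rewrite ltn_neqAle dimvS // andbT.
by apply: contra nHL => /eqP h; rewrite eqEdim HL h leqnn.
Qed.

(** Multiplication by [D], a common multiple of all positive codimensions in [L], turns the ratios
    into natural numbers, among which there is a least one. *)
Lemma exists_min_ratio (g : {vspace vT} -> nat) K L : (K <= L)%VS -> K != L ->
  exists H, [/\ (K <= H)%VS, (H <= L)%VS, H != L &
    forall H', (K <= H')%VS -> (H' <= L)%VS -> H' != L ->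
      (g H * (\dim L - \dim H') <= g H' * (\dim L - \dim H))%N].
Proof.
move=> KL nKL; pose D := (\dim L)`!.
pose cod H := (\dim L - \dim H)%N.
have cod0 H : (H <= L)%VS -> H != L -> (0 < cod H)%N.
  by move=> HL nHL; rewrite subn_gt0 ltn_dimv.
have codD H : (H <= L)%VS -> H != L -> (D %/ cod H * cod H = D)%N.
  move=> HL nHL; apply: divnK; apply: dvdn_fact; rewrite cod0 //=; exact: leq_subr.
pose P m := `[< exists H, [/\ (K <= H)%VS, (H <= L)%VS, H != L & m = (g H * (D %/ cod H))%N] >].
have exP : exists m, P m by exists (g K * (D %/ cod K))%N; apply/asboolP; exists K.
case: (ex_minnP exP) => m /asboolP[H [KH HL nHL ->]] hmin; exists H; split=> // H' KH' HL' nHL'.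
have /hmin h : P (g H' * (D %/ cod H'))%N by apply/asboolP; exists H'.
have D0 : (0 < D)%N by rewrite fact_gt0.
have h1 := codD _ HL nHL; have h2 := codD _ HL' nHL'.
rewrite -(leq_pmul2r D0) -/(cod H) -/(cod H').
have -> : (g H * cod H' * D = (g H * (D %/ cod H)) * (cod H * cod H'))%N by rewrite -{1}h1; ring.
have -> : (g H' * cod H * D = (g H' * (D %/ cod H')) * (cod H * cod H'))%N by rewrite -{1}h2; ring.
by rewrite leq_mul2r h orbT.
Qed.

Lemma lker_subr_projv H : lker (\1 - projv H)%VF = H.
Proof.
apply/vspaceP => w; rewrite memv_ker add_lfunE opp_lfunE id_lfunE subr_eq0.
by apply/eqP/idP => [->|wH]; [exact: memv_proj | rewrite projv_id].
Qed.

(* [\1 - projv H] serves as the quotient map by [H]. *)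
Lemma dim_img_quotient H U :
  (\dim (U + H) = \dim H + \dim ((\1 - projv H)%VF @: U))%N.
Proof.
have := limg_ker_dim (\1 - projv H)%VF U; rewrite lker_subr_projv.
by have := dimv_sum_cap U H; lia.
Qed.
End Quotients.

(** If, of [y] points in dimension [q], [z] lie in a subspace of dimension [r] and [x] are counted
    off it, then the minimality of [y / q] against [x / (q - r)] gives [z / y <= r / q]. *)
Lemma ratio_arith (x y z q r : nat) : (r <= q)%N -> (x + z <= y)%N ->
  (y * (q - r) <= x * q)%N -> (z * q <= y * r)%N.
Proof.
move=> rq xzy; have h1 : ((x + z) * q <= y * q)%N by rewrite leq_mul2r xzy orbT.
have h2 : (y * r <= y * q)%N by rewrite leq_mul2l rq orbT.
by rewrite mulnBr; rewrite mulnDl in h1; lia.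
Qed.

Section ThreeColours.
Variable C : numClosedFieldType.
Hypothesis archi : forall x : C, 0 <= x -> exists k : nat, x < k%:R.
Variables (vT : vectType C) (P : seq vT) (col : vT -> 'I_3).
Hypothesis uP : uniq P.
Hypothesis P_indep : {in P &, forall v w, v != w -> w \notin <[v]>%VS}.
Hypothesis P_col : {in P &, forall v w, v != w -> col v = col w ->
  exists z, [/\ z \in P, col z != col v & z \in (<[v]> + <[w]>)%VS]}.
Hypothesis P0 : 0 \notin P.

Definition colour_class a := [seq v <- P | col v == a].

(* 972 = 6 * 162, see [semistable_dim_bound]. *)
Lemma colour_step (K : {vspace vT}) : ~~ (<<P>> <= K)%VS ->
  exists a, ~~ (<<colour_class a>> <= K)%VS /\
    (\dim (K + <<colour_class a>>) <= \dim K + 972)%N.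
Proof.
move=> PK.
pose cnt a := count [pred v | (v \notin K) && (col v == a)] P.
have [v0 v0P v0K] : exists2 v, v \in P & v \notin K.
  apply/hasP; rewrite -[has _ _]negbK -all_predC; apply: contra PK => /allP h.
  by apply/span_subvP => v /h /=; rewrite negbK.
pose a := [arg max_(a > col v0) cnt a].
have amax b : (cnt b <= cnt a)%N by rewrite /a; case: arg_maxnP => // a' _; apply.
have a0 : (0 < cnt a)%N.
  apply: leq_trans (amax (col v0)); rewrite -has_count; apply/hasP; exists v0 => //=.
  by rewrite v0K eqxx.
exists a; split.
  move: a0; rewrite -has_count => /hasP[v vP /andP[vK /eqP va]].
  apply: contra vK => /subvP; apply; rewrite memv_span // mem_filter va eqxx //.
set L := (K + _)%VS.
have KL : (K <= L)%VS by exact: addvSl.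
have aL v : v \in P -> col v = a -> v \in L.
  move=> vP va; apply: (subvP (addvSr _ _)); rewrite memv_span // mem_filter va eqxx //.
have nKL : K != L.
  move: a0; rewrite -has_count => /hasP[v vP /andP[vK /eqP va]].
  by apply: contraNneq vK => ->; exact: aL.
pose g (H : {vspace vT}) := count [pred v | (v \in L) && (v \notin H)] P.
have [H [KH HL nHL hmin]] := exists_min_ratio g KL nKL.
set e := (\dim L - \dim H)%N in hmin.
have e0 : (0 < e)%N by rewrite subn_gt0 ltn_dimv.
pose X := [seq v <- P | (v \in L) && (v \notin H)].
have XE : size X = g H by rewrite size_filter.
have uX : uniq X by rewrite filter_uniq.
have XP v : v \in X -> [/\ v \in P, v \in L & v \notin H].
  by rewrite mem_filter => /andP[/andP[-> ->] ->].
(* Otherwise [H] would contain [K] and the class of [a], hence equal [L]. *)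
have [v1 v1X v1a] : exists2 v, v \in X & col v = a.
  have : ~~ all (mem H) (colour_class a).
    apply: contra nHL => /allP h; rewrite eqEsubv HL subv_add KH /=.
    by apply/span_subvP => v /h.
  rewrite -has_predC => /hasP[v]; rewrite mem_filter => /andP[/eqP va vP] /= vH.
  by exists v => //; rewrite mem_filter aL // vH.
have spX : (<<X>> + H = L)%VS.
  apply/eqP; rewrite eqEsubv !subv_add HL andbT; apply/andP; split.
    by apply/span_subvP => v /XP[].
  apply/andP; split; first by apply: subv_trans KH (addvSr _ _).
  apply/span_subvP => v; rewrite mem_filter => /andP[/eqP va vP].
  have [vH|vH] := boolP (v \in H); first exact: (subvP (addvSr _ _)).
  by apply: (subvP (addvSl _ _)); rewrite memv_span // mem_filter aL // vH.
have he : (e <= 162)%N.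
  pose f := (\1 - projv H)%VF.
  have fE w : (f w == 0) = (w \in H) by rewrite -memv_ker lker_subr_projv.
  pose v := tnth (in_tuple X).
  have vX i : v i \in X by exact: mem_tnth.
  have vI : injective v by apply/tuple_uniqP.
  have mapv : [seq f (v i) | i <- enum 'I_(size X)] = map f X.
    by rewrite (map_comp f v) (map_tnth_enum (in_tuple X)).
  have dimE (l : seq 'I_(size X)) :
     \dim (<<map v l>> + H) = (\dim H + \dim <<[seq f (v i) | i <- l]>>)%N.
    by rewrite dim_img_quotient limg_span -map_comp.
  apply: (@semistable_dim_bound _ archi vT (size X) e v f (col \o v)).
  - move=> i j ij; have [vi _ _] := XP _ (vX i); have [vj _ _] := XP _ (vX j).
    by apply: P_indep => //; rewrite (inj_eq vI).
  - move=> i j ij cij; have [vi viL _] := XP _ (vX i); have [vj vjL _] := XP _ (vX j).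
    have [|z [zP zc zl]] := P_col vi vj _ cij; first by rewrite (inj_eq vI).
    (* A third point in [H] is killed by [f]; one outside [H] belongs to the family. *)
    have [zH|zH] := boolP (z \in H).
      right; exists z; split=> //; first by apply: contraNneq P0 => <-.
      by apply/eqP; rewrite fE.
    have zX : z \in X.
      rewrite mem_filter zP zH !andbT; apply: subvP zl.
      by rewrite subv_add -!memvE viL vjL.
    left; have /tnthP[k zk] : z \in in_tuple X by [].
    rewrite -/(v k) in zk; exists k; split; last by rewrite -zk.
      by apply: contraNneq zc => ki; rewrite zk ki.
    by apply: contraNneq zc => kj; rewrite zk kj; apply/eqP; exact: esym cij.
  - have := dim_img_quotient H <<X>>; rewrite spX limg_span mapv => h.
    by rewrite /e h addKn.
  (* Semistability: the points of [l] lie in [H'], so [g H'] does not count them, and minimality is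
     applied to [H']. If [H' = L] it is no competitor, but then [r = e]. *)
  - move=> l ul; set r := \dim _.
    have dl : \dim (<<map v l>> + H) = (\dim H + r)%N by exact: dimE.
    set H' := (_ + H)%VS in dl.
    have H'L : (H' <= L)%VS.
      rewrite subv_add HL andbT; apply/span_subvP => w /mapP[i _ ->].
      by have [] := XP _ (vX i).
    have sl : (size l <= size X)%N by rewrite -[X in (_ <= X)%N]card_ord -(card_uniqP ul) max_card.
    have [H'E|nH'L] := eqVneq H' L.
      by rewrite H'E in dl; rewrite /e dl addKn leq_mul2r sl orbT.
    have := hmin H' (subv_trans KH (addvSr _ _)) H'L nH'L; rewrite -XE dl.
    have : (g H' + size l <= size X)%N.
      rewrite /g -(size_map v l) -size_filter -size_cat; apply: uniq_leq_size.
        rewrite cat_uniq filter_uniq // (map_inj_uniq vI) ul andbT /=.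
        apply/hasPn => w wl; have wH' : w \in H' by rewrite (subvP (addvSl _ _)) // memv_span.
        by rewrite /= mem_filter /= wH' andbF.
      move=> w; rewrite mem_cat => /orP[|/mapP[i _ ->]]; last exact: vX.
      rewrite !mem_filter /= => /andP[/andP[-> wH'] ->]; rewrite andbT /=.
      by apply: contra wH' => wH; apply: (subvP (addvSr _ _)).
    have : (r <= e)%N by rewrite /e leq_subRL ?dimvS // -dl dimvS.
    rewrite subnDA -/e => re xle hm; exact: ratio_arith re xle hm.
(* Distinct points [w] of colour [a] in [H] are joined to [v1] by lines whose points of other colours
   are distinct and lie off [H]. *)
have hx : (count [pred v | (v \in L) && (v \notin K)] P <= 6 * size X)%N.
  have h3 : (count [pred v | (v \in L) && (v \notin K)] P <= 3 * cnt a)%N.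
    apply: (@leq_trans (\sum_(b : 'I_3) cnt b)).
      rewrite -sum1_count (partition_big col xpredT) //=; apply: leq_sum => b _.
      rewrite sum1_count; apply: sub_count => v /=.
      by move=> /andP[/andP[_ ->] ->].
    apply: (@leq_trans (\sum_(b : 'I_3) cnt a)); first exact: leq_sum.
    by rewrite sum_nat_const card_ord.
  suff h2 : (cnt a <= 2 * size X)%N.
    by apply: leq_trans h3 _; rewrite (_ : 6 = 3 * 2)%N // -mulnA leq_mul2l.
  (* The points of colour [a] outside [K] either lie off [H], hence in [X], or form [W], which [zf]
     injects into [X]. *)
  pose W := [seq w <- P | [&& w \notin K, col w == a & w \in H]].
  have -> : cnt a = (count [pred v | [&& v \notin K, col v == a & v \notin H]] P + size W)%N.
    rewrite size_filter /cnt; elim: (P) => //= v s ->.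
    by case: (v \notin K); case: (col v == a); case: (v \in H); rewrite //= addnS.
  rewrite mul2n -addnn; apply: leq_add.
    rewrite -size_filter; apply: uniq_leq_size; first exact: filter_uniq.
    move=> v; rewrite !mem_filter /= => /andP[/and3P[_ /eqP va vH] vP].
    by rewrite aL // vH.
  have WP w : w \in W -> [/\ w \in P, col w = a & w \in H].
    by rewrite mem_filter => /andP[/and3P[_ /eqP-> ->] ->].
  have [v1P v1L v1H] := XP _ v1X.
  (* For [w] in [W] the list is nonempty, so the default [v1] is not taken. *)
  pose zf w := head v1 [seq z <- P | (col z != a) && (z \in <[v1]> + <[w]>)%VS].
  have zfP w : w \in W -> [/\ zf w \in P, col (zf w) != a & zf w \in (<[v1]> + <[w]>)%VS].
    move=> /WP[wP wa wH]; have v1w : v1 != w by apply: contraNneq v1H => ->.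
    have [|z [zP zc zl]] := P_col v1P wP v1w; first by rewrite v1a wa.
    have : zf w \in [seq z <- P | (col z != a) && (z \in <[v1]> + <[w]>)%VS].
      have : z \in [seq z <- P | (col z != a) && (z \in <[v1]> + <[w]>)%VS].
        by rewrite mem_filter zP zl -v1a zc.
      by rewrite /zf; case: [seq _ <- _ | _] => // y s _; exact: mem_head.
    by rewrite mem_filter => /andP[/andP[-> ->] ->].
  rewrite -(size_map zf); apply: uniq_leq_size.
    rewrite map_inj_in_uniq ?filter_uniq // => w w' wW w'W zz.
    have [zP zc /memv_addP[_ /vlineP[y ->] [_ /vlineP[b ->] zE]]] := zfP _ wW.
    have [_ _ /memv_addP[_ /vlineP[y' ->] [_ /vlineP[b' ->] zE']]] := zfP _ w'W.
    have [wP wa wH] := WP _ wW; have [w'P w'a w'H] := WP _ w'W.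
    (* As [w] and [w'] are in [H] and [v1] is not, the common point determines its coefficient at
       [v1]; hence [w] and [w'] are proportional. *)
    have yy : y = y'.
      apply/eqP; rewrite -subr_eq0; apply: contraNT v1H => yy.
      have h : (y - y') *: v1 = b' *: w' - b *: w.
        by rewrite -[b' *: w'](addKr (y' *: v1)) -zE' -zz zE addrA addrK addrC scalerBl.
      have : (y - y') *: v1 \in H by rewrite h memvB // memvZ.
      by rewrite rpredZeq (negPf yy).
    apply/eqP/negPn/negP => ww'.
    have bw : b *: w = b' *: w'.
      by apply: (addrI (y *: v1)); rewrite -zE zz zE' yy.
    have b0 : b != 0.
      apply/eqP => b0; have := P_indep v1P zP; rewrite zE b0 scale0r addr0 memvZ ?memv_line //.
      move=> /(_ _)/negP; apply=> //; apply: contraNneq zc => zv.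
      by rewrite zE b0 scale0r addr0 -zv v1a.
    have := P_indep w'P wP; rewrite eq_sym ww' => /(_ isT).
    by rewrite -(scalerK b0 w) bw !memvZ // memv_line.
  move=> _ /mapP[w wW ->]; have [zP zc zl] := zfP _ wW; have [wP wa wH] := WP _ wW.
  rewrite mem_filter zP andbT; apply/andP; split.
    by apply: subvP zl; rewrite subv_add -!memvE v1L aL.
  move/memv_addP: zl => [_ /vlineP[y ->] [_ /vlineP[b ->] zE]].
  have [y0|y0] := eqVneq y 0.
    have : w != zf w by apply: contraNneq zc => <-; rewrite wa.
    by move=> /(P_indep wP zP); rewrite zE y0 scale0r add0r memvZ // memv_line.
  apply: contra v1H; rewrite zE => h.
  have : y *: v1 \in H by rewrite -(addrK (b *: w) (y *: v1)) memvB // memvZ.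
  by rewrite rpredZeq (negPf y0).
have h := hmin K (subvv K) KL nKL; rewrite -XE in h.
have X0 : (0 < size X)%N by case: (X) v1X.
have h' : (size X * (\dim L - \dim K) <= size X * 972)%N.
  apply: leq_trans h _; rewrite (_ : 972 = 6 * 162)%N // mulnA [(size X * 6)%N]mulnC.
  exact: leq_mul.
by rewrite leq_pmul2l // leq_subLR in h'.
Qed.
(** Induction on the number of colour classes not contained in [K]: each use of [colour_step]
    absorbs at least one, and [2916 = 3 * 972]. *)
Lemma three_colour_span_dim : (\dim <<P>> <= 2916)%N.
Proof.
suff gen m (K : {vspace vT}) : (#|[set a | ~~ (<<colour_class a>> <= K)%VS]| <= m)%N ->
    (\dim (K + <<P>>) <= \dim K + 972 * m)%N.
  have := gen 3 0%VS; rewrite add0v dimv0; apply.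
  by rewrite -[3 in X in (_ <= X)%N]card_ord max_card.
elim: m K => [|m IH] K hK; have [PK|PK] := boolP (<<P>> <= K)%VS; try by
    rewrite (addv_idPl PK) leq_addr.
- have [a [aK _]] := colour_step PK.
  have : a \in [set a | ~~ (<<colour_class a>> <= K)%VS] by rewrite inE.
  by move: hK; rewrite leqn0 cards_eq0 => /eqP->; rewrite inE.
have [a [aK ha]] := colour_step PK; set K' := (K + _)%VS in ha.
have PK' : (K + <<P>> <= K' + <<P>>)%VS by rewrite addvS // addvSl.
apply: leq_trans (dimvS PK') (leq_trans (IH K' _) _); last by rewrite mulnS addnA leq_add2r.
rewrite -ltnS; apply: leq_trans hK; apply: proper_card; apply/properP; split.
  apply/fintype.subsetP => b; rewrite !inE; apply: contra => bK.
  exact: subv_trans bK (addvSl _ _).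
by exists a; rewrite !inE // negbK addvSr.
Qed.
End ThreeColours.

(** * Affine configurations over the complex numbers *)

Lemma archimedean_complex (R : realType) (x : R[i]) : 0 <= x -> exists k : nat, x < k%:R.
Proof.
move=> x0; exists (Num.bound (complex.Re x)); rewrite -(RRe_real (ger0_real x0)).
rewrite -(rmorph_nat (real_complex R)) ltcR; apply: archi_boundP.
by move: x0; rewrite lecE => /andP[].
Qed.

Lemma row_mx1_line (F : fieldType) d (v w : 'rV[F]_d) :
  row_mx w (1 : 'M_1) \in <[row_mx v (1 : 'M_1)]>%VS -> w = v.
Proof.
move=> /vlineP[k]; rewrite scale_row_mx => /eq_row_mx[-> /matrixP/(_ 0 0)].
by rewrite !mxE eqxx mulr1 => <-; rewrite scale1r.
Qed.

Local Open Scope classical_set_scope.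

Theorem theorem6p4 :
  exists C : nat,
    forall (R : realType) (d : nat) (V1 V2 V3 : set 'rV[R[i]]_d),
      finite_set V1 -> finite_set V2 -> finite_set V3 ->
      V1 `&` V2 = set0 -> V1 `&` V3 = set0 -> V2 `&` V3 = set0 ->
      three_MR V1 V2 V3 ->
      (adim (V1 `|` V2 `|` V3) <= C)%N.
Proof.
exists 2916%N => R d V1 V2 V3 /finite_seqP[s1 E1] /finite_seqP[s2 E2] /finite_seqP[s3 E3].
rewrite {}E1 {}E2 {}E3 => d12 d13 d23 MR.
pose s := undup (s1 ++ s2 ++ s3).
(* Appending a coordinate one makes any two distinct points independent and puts their line into the
   plane they span. *)
pose h (v : 'rV[R[i]]_d) : 'rV[R[i]]_(d + 1) := row_mx v 1.
have hI : injective h by move=> v w /eq_row_mx[].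
pose P := map h s.
(* Points of the third set get colour 2, since disjointness excludes the first two tests. *)
pose c (v : 'rV[R[i]]_d) : 'I_3 := if v \in s1 then 0 else if v \in s2 then 1 else 2.
pose col (w : 'rV[R[i]]_(d + 1)) := c (lsubmx w).
have colh v : col (h v) = c v by rewrite /col row_mxKl.
have c1 v : v \in s1 -> c v = 0 by rewrite /c => ->.
have c2 v : v \in s2 -> c v = 1.
  move=> v2; rewrite /c v2; case: ifP => // v1.
  by have : ([set` s1] `&` [set` s2]) v by []; rewrite d12.
have c3 v : v \in s3 -> c v = 2.
  move=> v3; rewrite /c; case: ifP => v1.
    by have : ([set` s1] `&` [set` s3]) v by []; rewrite d13.
  case: ifP => // v2.
  by have : ([set` s2] `&` [set` s3]) v by []; rewrite d23.
have memV v : ([set` s1] `|` [set` s2] `|` [set` s3]) v <-> v \in s.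
  rewrite mem_undup !mem_cat /=; split.
    by move=> [[|]|] /= ->; rewrite ?orbT.
  by move=> /or3P[] ?; [left; left|left; right|right].
have uP : uniq P by rewrite map_inj_uniq // undup_uniq.
have P_indep : {in P &, forall v w, v != w -> w \notin <[v]>%VS}.
  move=> _ _ /mapP[v _ ->] /mapP[w _ ->]; apply: contra => /row_mx1_line ->.
  by rewrite eqxx.
have P0 : 0 \notin P.
  apply/negP => /mapP[v _ /matrixP/(_ 0 (rshift d 0))].
  by rewrite row_mxEr !mxE eqxx => /eqP; rewrite eq_sym oner_eq0.
have P_col : {in P &, forall v w, v != w -> col v = col w ->
    exists z, [/\ z \in P, col z != col v & z \in (<[v]> + <[w]>)%VS]}.
  move=> _ _ /mapP[v vs ->] /mapP[w ws ->]; rewrite (inj_eq hI) !colh => vw cvw.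
  pose L := [set v + t *: (w - v) | t in [set: R[i]]].
  have Lline : line L by exists v, (w - v); rewrite subr_eq0 eq_sym.
  have two : exists x y, [/\ x <> y, (L `&` ([set` s1] `|` [set` s2] `|` [set` s3])) x
      & (L `&` ([set` s1] `|` [set` s2] `|` [set` s3])) y].
    exists v, w; split; first exact/eqP.
      by split; [exists 0; rewrite // scale0r addr0 | apply/memV].
    by split; [exists 1; rewrite // scale1r addrC subrK | apply/memV].
  suff [z [zs zL zc]] : exists z, [/\ z \in s, L z & c z != c v].
    exists (h z); rewrite !colh; split=> //; first exact: map_f.
    case: zL => t _ zE.
    have -> : h z = (1 - t) *: h v + t *: h w.
      rewrite /h !scale_row_mx add_row_mx -zE; congr row_mx.
        by rewrite scalerBr scalerBl scale1r -[RHS]addrA [- _ + _]addrC.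
      by rewrite -scalerDl subrK scale1r.
    by rewrite memv_add // memvZ // memv_line.
  (* Of two classes met by [L], at least one has a colour other than that of [v]. *)
  have pick a b (sa sb : seq 'rV[R[i]]_d) : {subset sa <= s} -> {subset sb <= s} ->
      (forall v, v \in sa -> c v = a) -> (forall v, v \in sb -> c v = b) -> a != b ->
      Defs.meets L [set` sa] -> Defs.meets L [set` sb] -> exists z, [/\ z \in s, L z & c z != c v].
    move=> sas sbs ca cb ab [x [Lx /= xa]] [y [Ly /= yb]].
    have [av|av] := eqVneq a (c v).
      by exists y; rewrite (cb _ yb) -av eq_sym ab (sbs _ yb).
    by exists x; rewrite (ca _ xa) av (sas _ xa).
  have S1 : {subset s1 <= s} by move=> x; rewrite mem_undup !mem_cat => ->.
  have S2 : {subset s2 <= s} by move=> x; rewrite mem_undup !mem_cat => ->; rewrite orbT.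
  have S3 : {subset s3 <= s} by move=> x; rewrite mem_undup !mem_cat => ->; rewrite !orbT.
  case: (MR L Lline two) => [[]|[]|[]].
  - exact: pick S1 S2 c1 c2 _.
  - exact: pick S1 S3 c1 c3 _.
  - exact: pick S2 S3 c2 c3 _.
have dP := three_colour_span_dim (@archimedean_complex R) uP P_indep P_col P0.
(* Forgetting the last coordinate is linear and recovers the points, so differences of points lie in
   the image of [<<P>>]. *)
pose f : 'Hom('rV[R[i]]_(d + 1), 'rV[R[i]]_d) := linfun lsubmx.
have fh v : f (h v) = v by rewrite lfunE /= row_mxKl.
(* The default 0 occurs only for empty [s], when the inclusion [VW] is vacuous. *)
pose a := head 0 s.
have VW : [set` s1] `|` [set` s2] `|` [set` s3] `<=` translate a (f @: <<P>>)%VS.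
  move=> v /memV vs; rewrite /translate /=.
  have as_ : a \in s by rewrite /a; case: (s) vs => // y l _; exact: mem_head.
  by rewrite -(fh v) -(fh a) rpredB // memv_img // memv_span // map_f.
apply: leq_trans (adim_le VW) (leq_trans _ dP).
by have := limg_ker_dim f <<P>>%VS => <-; rewrite leq_addl.
Qed.
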